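(* Let $K$ be a compact Hausdorff space, let $X$ be a real Banach space, and let $Y$ be a proper $M$-ideal of $X$. Then: (1) If $C(K,Y)$ has the Strong diameter two property (respectively the diameter two property, the Slice diameter two property), then $C(K,X)$ has the Strong diameter two property (respectively the diameter two property, the Slice diameter two property). (2) If $C(K,X)^*$ has the $w^*$-Strong diameter two property (respectively the $w^*$-diameter two property, the $w^*$-Slice diameter two property), then $C(K,Y)^*$ has the $w^*$-Strong diameter two property (respectively the $w^*$-diameter two property, the $w^*$-Slice diameter two property).
   Context: All Banach spaces are real and nonzero (in particular $Y \neq \{0\}$ and $K \neq \emptyset$). For a Banach space $Z$, $C(K,Z)$ is the Banach space of continuous functions from $K$ to $Z$ with the supremum norm, $Z^*$ is the dual of $Z$ and $B_Z$ its closed unit ball. Diameters are taken with respect to the norm. $M$-ideals. A linear projection $P$ on a Banach space $Z$ is an $L$-projection if $\|z\| = \|Pz\| + \|z - Pz\|$ for all $z \in Z$. For a subspace $Y \subseteq X$, its annihilator is $Y^\perp = \{x^* \in X^* : x^*(y) = 0 \ \forall y \in Y\}$. A closed subspace $Y \subseteq X$ is an $M$-ideal in $X$ if there is an $L$-projection $P : X^* \to X^*$ with $\ker P = Y^\perp$. It is proper if $Y \neq X$. Slices. For a Banach space $Z$, a slice of $B_Z$ is a set of the form $\{z \in B_Z : f(z) > \sup f(B_Z) - \alpha\}$ with $f \in Z^*$ and $\alpha > 0$. A $w^*$-slice of $B_{Z^*}$ is a set of the form $\{z^* \in B_{Z^*} : z^*(z) > \sup_{u^* \in B_{Z^*}}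 u^*(z) - \alpha\}$ with $z \in Z$ and $\alpha > 0$. A convex combination of slices (respectively $w^*$-slices) is a set $\sum_{i=1}^n \lambda_i S_i = \{\sum_{i=1}^n \lambda_i s_i : s_i \in S_i\}$, where $n \geq 1$, each $S_i$ is a slice (respectively $w^*$-slice) of the unit ball in question, $\lambda_i \in [0,1]$ and $\sum_{i=1}^n \lambda_i = 1$. A Banach space $Z$ has: - the Slice diameter two property if every slice of $B_Z$ has diameter $2$; - the diameter two property if every nonempty relatively weakly open subset of $B_Z$ has diameter $2$; - the Strong diameter two property if every convex combination of slices of $B_Z$ has diameter $2$. A dual space $Z^*$ has: - the $w^*$-Slice diameter two property if every $w^*$-slice of $B_{Z^*}$ has diameter $2$; - the $w^*$-diameter two property if every nonempty relatively $w^*$-open subset of $B_{Z^*}$ (for the topology $\sigma(Z^*,Z)$) has diameter $2$; - the $w^*$-Strong diameter two property if every convex combination of $w^*$-slices of $B_{Z^*}$ has diameter $2$. *)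

(* Defs.v *)
From HB Require Import structures.
From mathcomp Require Import all_boot all_order all_algebra.
From mathcomp Require Import all_classical all_reals all_analysis.

Set Implicit Arguments.
Unset Strict Implicit.
Unset Printing Implicit Defensive.

Import Order.TTheory GRing.Theory Num.Theory.
Import numFieldNormedType.Exports.

Local Open Scope classical_set_scope.
Local Open Scope ring_scope.

Section sup_real.
Context {R : realType}.

Lemma sup_ge0 (A : set R) : (forall x, A x -> 0 <= x) -> 0 <= sup A.
Proof.
move=> A0; have [[[x Ax] hA]|/sup_out->//] := pselect (has_sup A).
by apply: (le_trans (A0 _ Ax)); apply: ub_le_sup.
Qed.

End sup_real.

(** Linear subspaces of [X] are predicates [Y : submodClosed X];
    [subnormed Y] is such a subspace seen as a normed space on its own. *)

Section subnormed.
Context {R : realType} {X : normedModType R}.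

Record subnormed (Y : submodClosed X) := SubNormed {
  subnormed_val :> X ;
  _ : subnormed_val \in Y }.

Variable Y : submodClosed X.

HB.instance Definition _ := [isSub for @subnormed_val Y].
HB.instance Definition _ := [Choice of subnormed Y by <:].
HB.instance Definition _ := [SubChoice_isSubLmodule of subnormed Y by <:].

Let nm (y : subnormed Y) : R := `|\val y|.

Let nmD y z : nm (y + z) <= nm y + nm z.
Proof. by rewrite /nm raddfD ler_normD. Qed.

Let nmZ (a : R) y : nm (a *: y) = `|a| * nm y.
Proof. by rewrite /nm linearZ normrZ. Qed.

Let nm0 y : nm y = 0 -> y = 0.
Proof. by move=> /normr0_eq0 y0; apply: val_inj; rewrite y0 raddf0. Qed.

HB.instance Definition _ :=
  Lmodule_isNormed.Build R (subnormed Y) nmD nmZ nm0.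

Lemma subnormed_normE (y : subnormed Y) : `|y| = `|\val y|.
Proof. by []. Qed.

End subnormed.

(** [contfun cK Z] is C(K, Z) with the supremum norm. The compactness proof
    [cK] is an index of the type, since the norm is only defined for compact
    [K]. *)

Definition cont_pred {K : topologicalType} {R : realType} {Z : normedModType R}
  : {pred K -> Z} := mem [set f : K -> Z | continuous f].

Record contfun {R : realType} {K : topologicalType} (cK : compact [set: K])
    (Z : normedModType R) := ContFun {
  contfun_val :> K -> Z ;
  _ : contfun_val \in cont_pred }.

Section contfun.
Context {R : realType} {K : topologicalType} (cK : compact [set: K]).
Variable Z : normedModType R.

Let cont_submod_closed : submod_closed (@cont_pred K R Z).
Proof.
split=> [|a f g]; rewrite !inE/=; first exact: cst_continuous.
by move=> cf cg x; apply: cvgD; [apply: cvgZl_tmp; exact: cf|exact: cg].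
Qed.

HB.instance Definition _ :=
  GRing.isSubmodClosed.Build R (K -> Z) cont_pred cont_submod_closed.

HB.instance Definition _ := [isSub for @contfun_val R K cK Z].
HB.instance Definition _ := [Choice of contfun cK Z by <:].
HB.instance Definition _ := [SubChoice_isSubLmodule of contfun cK Z by <:].

Implicit Types f g : contfun cK Z.

Lemma contfun_continuous f : continuous (f : K -> Z).
Proof. by have /set_mem := valP f. Qed.

Let nm f : R := sup [set `|f t| | t in [set: K]].

Let nm_ub f : has_ubound [set `|f t| | t in [set: K]].
Proof.
have cf : {within [set: K], continuous (f : K -> Z)}.
  by apply: continuous_subspaceT; exact: contfun_continuous.
have [M [_ fM]] := compact_bounded (continuous_compact cf cK).
exists (M + 1) => _ [t _ <-]; apply: (fM (M + 1)); first by rewrite ltrDl.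
by exists t.
Qed.

Let nm_ge f t : `|f t| <= nm f.
Proof. by apply: ub_le_sup; [exact: nm_ub|exists t]. Qed.

Let nm_ge0 f : 0 <= nm f.
Proof. by apply: sup_ge0 => _ [t _ <-]. Qed.

Let nm_le f (M : R) : 0 <= M -> (forall t, `|f t| <= M) -> nm f <= M.
Proof.
move=> M0 fM; rewrite /nm.
have [[x Ax]|/nonemptyPn->] :=
  pselect ([set `|f t| | t in [set: K]] !=set0); last by rewrite sup0.
by apply: ge_sup; [exists x|move=> _ [t _ <-]].
Qed.

Let nmD f g : nm (f + g) <= nm f + nm g.
Proof.
apply: nm_le => [|t]; first by rewrite addr_ge0 ?nm_ge0.
by rewrite (le_trans (ler_normD _ _))// lerD ?nm_ge.
Qed.

Let nmZ_le (a : R) f : nm (a *: f) <= `|a| * nm f.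
Proof.
apply: nm_le => [|t]; first by rewrite mulr_ge0 ?nm_ge0.
by rewrite [_ t]/(a *: f t) normrZ ler_wpM2l ?nm_ge.
Qed.

Let nmZ (a : R) f : nm (a *: f) = `|a| * nm f.
Proof.
apply/eqP; rewrite eq_le nmZ_le/=.
have [->|a0] := eqVneq a 0; first by rewrite normr0 mul0r.
rewrite -ler_pdivlMl ?normr_gt0// -normfV.
by rewrite (le_trans _ (nmZ_le _ _))// scalerA mulVf// scale1r.
Qed.

Let nm0 f : nm f = 0 -> f = 0.
Proof.
move=> f0; apply: val_inj; apply/funext => t; apply/normr0_eq0/eqP.
by rewrite eq_le normr_ge0 andbT -[leRHS]f0 nm_ge.
Qed.

HB.instance Definition _ :=
  Lmodule_isNormed.Build R (contfun cK Z) nmD nmZ nm0.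

Lemma contfun_normE f : `|f| = sup [set `|f t| | t in [set: K]].
Proof. by []. Qed.

End contfun.

Definition unit_ball {R : realType} (Z : normedModType R) : set Z :=
  [set z | `|z| <= 1].
Arguments unit_ball {R} Z.

(** Topological dual with the operator norm. *)

Definition dual_pred {R : realType} {Z : normedModType R} : {pred Z -> R} :=
  mem [set f : Z -> R | scalar f /\ continuous f].

Record dual {R : realType} (Z : normedModType R) := Dual {
  dual_val :> Z -> R ;
  _ : dual_val \in dual_pred }.

Section dual.
Context {R : realType} (Z : normedModType R).

Let dual_submod_closed : submod_closed (@dual_pred R Z).
Proof.
split=> [|a f g]; rewrite !inE/=.
  split; last exact: cst_continuous.
  by move=> b x y; rewrite mulr0 addr0.
move=> [lf cf] [lg cg]; split.
  move=> b x y; have afgE z : (a *: f + g) z = a * f z + g z by [].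
  by rewrite !afgE lf lg !mulrDr mulrCA addrACA.
by move=> x; apply: cvgD; [apply: cvgZl_tmp; exact: cf|exact: cg].
Qed.

HB.instance Definition _ :=
  GRing.isSubmodClosed.Build R (Z -> R) dual_pred dual_submod_closed.

HB.instance Definition _ := [isSub for @dual_val R Z].
HB.instance Definition _ := [Choice of dual Z by <:].
HB.instance Definition _ := [SubChoice_isSubLmodule of dual Z by <:].

Implicit Types f g : dual Z.

Lemma dual_scalar f : scalar (f : Z -> R).
Proof. by have /set_mem[] := valP f. Qed.

Lemma dual_continuous f : continuous (f : Z -> R).
Proof. by have /set_mem[] := valP f. Qed.

HB.instance Definition _ f :=
  GRing.isLinear.Build R Z R *%R (dual_val f) (dual_scalar f).

Let nm f : R := sup [set `|f z| | z in unit_ball Z].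

Let nm_ub f : has_ubound [set `|f z| | z in unit_ball Z].
Proof.
have /linear_bounded_continuous/bounded_funP/(_ 1)[M fM] :=
  @dual_continuous f.
by exists M => _ [z z1 <-]; exact: fM.
Qed.

Let nm_ge f z : `|z| <= 1 -> `|f z| <= nm f.
Proof. by move=> z1; apply: ub_le_sup; [exact: nm_ub|exists z]. Qed.

Let nm_ge0 f : 0 <= nm f.
Proof. by apply: sup_ge0 => _ [t _ <-]. Qed.

Let nm_le f (M : R) : (forall z, `|z| <= 1 -> `|f z| <= M) -> nm f <= M.
Proof.
move=> fM; apply: ge_sup; last by move=> _ [t t1 <-]; exact: fM.
by exists `|f 0|, 0 => //=; rewrite /unit_ball/= normr0.
Qed.

Let nmD f g : nm (f + g) <= nm f + nm g.
Proof.
by apply: nm_le => z z1; rewrite (le_trans (ler_normD _ _))// lerD// nm_ge.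
Qed.

Let nmZ_le (a : R) f : nm (a *: f) <= `|a| * nm f.
Proof.
apply: nm_le => z z1.
by rewrite [_ z]/(a * f z) normrM ler_wpM2l// nm_ge.
Qed.

Let nmZ (a : R) f : nm (a *: f) = `|a| * nm f.
Proof.
apply/eqP; rewrite eq_le nmZ_le/=.
have [->|a0] := eqVneq a 0; first by rewrite normr0 mul0r.
rewrite -ler_pdivlMl ?normr_gt0// -normfV.
by rewrite (le_trans _ (nmZ_le _ _))// scalerA mulVf// scale1r.
Qed.

Let nm0 f : nm f = 0 -> f = 0.
Proof.
move=> f0; apply: val_inj; apply/funext => z.
have [->|z0] := eqVneq z 0; first exact: (linear0 f).
apply/normr0_eq0/eqP; rewrite eq_le normr_ge0 andbT.
have : `|f (`|z|^-1 *: z)| <= nm f by apply: nm_ge; rewrite normfZV.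
by rewrite f0 linearZ/= normrM pmulr_rle0// normr_gt0 invr_neq0// normr_eq0.
Qed.

HB.instance Definition _ := Lmodule_isNormed.Build R (dual Z) nmD nmZ nm0.

Lemma dual_normE f : `|f| = sup [set `|f z| | z in unit_ball Z].
Proof. by []. Qed.

End dual.

Section M_ideal.
Context {R : realType}.

Definition L_projection {Z : normedModType R} (P : {linear Z -> Z}) : Prop :=
  (forall z, P (P z) = P z) /\ (forall z, `|z| = `|P z| + `|z - P z|).

Definition annihilator {X : normedModType R} (Y : submodClosed X)
  : set (dual X) := [set f | forall y, y \in Y -> f y = 0].

Definition M_ideal {X : normedModType R} (Y : submodClosed X) : Prop :=
  closed [set` Y] /\
  exists P : {linear dual X -> dual X},
    L_projection P /\ [set f | P f = 0] = annihilator Y.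

End M_ideal.

Section weak_topologies.
Context {R : realType} (Z : normedModType R).

Definition weak : Type :=
  initial_topology (fun (z : Z) => (fun f => f z) : {ptws dual Z -> R}).

Definition weak_star : Type :=
  initial_topology (fun (f : dual Z) => (f : Z -> R) : {ptws Z -> R}).

HB.instance Definition _ := Topological.on weak.
HB.instance Definition _ := Topological.on weak_star.

End weak_topologies.

Section diameter_two.
Context {R : realType}.

(* Valued in [\bar R], so that the diameter of an unbounded set is [+oo]
   (the empty set gets [-oo]). *)
Definition diameter {Z : normedModType R} (A : set Z) : \bar R :=
  ereal_sup [set `|x - y|%:E | x in A & y in A].

Definition slice {Z : normedModType R} (f : dual Z) (a : R) : set Z :=
  [set z | unit_ball Z z /\ sup [set f u | u in unit_ball Z] - a < f z].

Definition wstar_slice {Z : normedModType R} (z : Z) (a : R) : set (dual Z) :=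
  [set f | unit_ball (dual Z) f /\
           sup [set g z | g in unit_ball (dual Z)] - a < (f : dual Z) z].

Definition is_slice {Z : normedModType R} (S : set Z) : Prop :=
  exists (f : dual Z) (a : R), 0 < a /\ S = slice f a.

Definition is_wstar_slice {Z : normedModType R} (S : set (dual Z)) : Prop :=
  exists (z : Z) (a : R), 0 < a /\ S = wstar_slice z a.

Definition is_convex_combination {Z : normedModType R} (isS : set Z -> Prop)
    (C : set Z) : Prop :=
  exists (n : nat) (l : 'I_n -> R) (S : 'I_n -> set Z),
    [/\ (0 < n)%N,
        forall i, isS (S i),
        forall i, 0 <= l i <= 1,
        \sum_(i < n) l i = 1 &
        C = [set \sum_(i < n) l i *: s i | s in [set s | forall i, S i (s i)]]].

Definition slice_D2P (Z : normedModType R) : Prop :=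
  forall S : set Z, is_slice S -> diameter S = 2%:E.

Definition D2P (Z : normedModType R) : Prop :=
  forall U : set (weak Z), open U ->
    (U : set Z) `&` unit_ball Z !=set0 ->
    diameter ((U : set Z) `&` unit_ball Z) = 2%:E.

Definition strong_D2P (Z : normedModType R) : Prop :=
  forall C : set Z, is_convex_combination is_slice C -> diameter C = 2%:E.

(* The w*-properties are properties of [dual Z] relative to its predual [Z]. *)
Definition wstar_slice_D2P (Z : normedModType R) : Prop :=
  forall S : set (dual Z), is_wstar_slice S -> diameter S = 2%:E.

Definition wstar_D2P (Z : normedModType R) : Prop :=
  forall U : set (weak_star Z), open U ->
    (U : set (dual Z)) `&` unit_ball (dual Z) !=set0 ->
    diameter ((U : set (dual Z)) `&` unit_ball (dual Z)) = 2%:E.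

Definition wstar_strong_D2P (Z : normedModType R) : Prop :=
  forall C : set (dual Z),
    is_convex_combination is_wstar_slice C -> diameter C = 2%:E.

End diameter_two.

(* Main.v *)
Require Import Defs.
From HB Require Import structures.
From mathcomp Require Import all_boot all_order all_algebra.
From mathcomp Require Import all_classical all_reals all_analysis.
From mathcomp Require Import ring lra.
Set Implicit Arguments.
Unset Strict Implicit.
Unset Printing Implicit Defensive.
Import Order.TTheory GRing.Theory Num.Theory.
Import numFieldNormedType.Exports.
Local Open Scope classical_set_scope.
Local Open Scope ring_scope.

(** Write [Z] for C(K, Y), [W] for C(K, X) and [J : Z -> W] for the inclusion.
    Everything rests on an intersection property of balls, [ball_property J]:
    for [w] in the unit ball of [W] and finitely many [y_i] in that of [Z] there
    is a [z] in [Z] with [`|z| <= 1 + e] and [`|w + J y_i - J z| <= 1 + e] for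
    all [i].

    An M-ideal has this property ([M_ideal_ball_property]): if there were no such
    [z], a functional on a finite power of [X] would separate, and the additivity
    of the norm along the L-projection excludes it. Unlike the L-projection
    itself, whose analogue for C(K, X) lives on a space of vector measures, the
    property passes directly to continuous functions: local choices of
    [z] are glued by a partition of unity ([ball_property_contfun]).

    The property gives back as much of the L-projection on the dual of [W] as is
    needed. A functional [f] on [W] has a part [S f] that lives on [Z], of norm
    at most that of the restriction of [f] to [Z], and [S f w] is
    approximated by the values [f (J z)] at points [z] of the ball property for
    [w] ([shadow], [approximation]).

    For the first half, the points [x + J y - J z] (scaled by [1 / (1 + d)]) carry
    large differences from [Z] to [W]: at such a point [f] is about
    [(f - S f) x + f (J y)], since [S f x] and [f (J z)] cancel, and two choices of
    [y] with the same [x] and [z] give points whose difference has the norm of the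
    difference of the [y]'s. Choosing [x] and [y] almost norming for [f - S f]
    and for the restriction of [f] puts the point in a given slice; choosing
    [x = w0] and [f (J y)] close to [S f w0] puts it in a weak neighbourhood of
    [w0].

    For the second half, functionals on [W] in the unit ball that almost attain
    norm [1] on the unit ball of [Z] are almost determined by their restrictions
    to [Z] ([concentration]), so that two of them that are far apart have
    restrictions that are far apart. A w*-slice of the dual ball of [Z] contains
    restrictions of such functionals. A w*-open set that meets this ball also
    does, because it contains functionals of norm almost [1]; the failure of this
    would make the norm w*-continuous on the dual of [Z], which the assumption
    on the dual of [W] excludes ([wstar_D2P_transfer]). *)

(** * The Hahn-Banach theorem *)

Section sublinear.
Context {R : realType} {V : lmodType R}.
Implicit Types p q : V -> R.

Definition sublinear p : Prop :=
  (forall u v, p (u + v) <= p u + p v) /\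
  (forall a v, 0 < a -> p (a *: v) <= a * p v).

Lemma sublinear_scale p a v :
  sublinear p -> 0 < a -> p (a *: v) = a * p v.
Proof.
move=> [_ pZ] a0; apply/eqP; rewrite eq_le pZ//=.
have ai0 : 0 < a^-1 by rewrite invr_gt0.
by have := pZ _ (a *: v) ai0; rewrite scalerA mulVf ?gt_eqF// scale1r ler_pdivlMl.
Qed.

Lemma sublinear0 p : sublinear p -> p 0 = 0.
Proof.
move=> sp; have := @sublinear_scale p 2 0 sp; rewrite scaler0 => /(_ (ltr0n _ 2)).
lra.
Qed.

Lemma sublinear_scale_ge0 p a v :
  sublinear p -> 0 <= a -> p (a *: v) = a * p v.
Proof.
move=> sp; rewrite le_eqVlt => /predU1P[<-|]; last exact: sublinear_scale.
by rewrite scale0r mul0r sublinear0.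
Qed.

Lemma sublinear_opp p v : sublinear p -> - p (- v) <= p v.
Proof.
move=> sp; have := sp.1 v (- v); rewrite subrr sublinear0//; lra.
Qed.

(** The sublinear functionals used here are infima of simpler functions over a
    family that is downward directed in this weak sense. *)
Lemma inf_sublinear (I : Type) (D : set I) (F : I -> V -> R) :
  D !=set0 ->
  (forall v, exists m, forall i, D i -> m <= F i v) ->
  (forall i j u v, D i -> D j ->
     exists2 k, D k & F k (u + v) <= F i u + F j v) ->
  (forall i a v, D i -> 0 < a -> exists2 k, D k & F k (a *: v) <= a * F i v) ->
  sublinear (fun v => inf [set F i v | i in D]).
Proof.
move=> [i0 Di0] lbF FD FZ.
have lb v : has_lbound [set F i v | i in D].
  by have [m mF] := lbF v; exists m => _ [i Di <-]; exact: mF.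
have ne v : [set F i v | i in D] !=set0 by exists (F i0 v), i0.
have infle v i : D i -> inf [set F i v | i in D] <= F i v.
  by move=> Di; apply: ge_inf; [exact: lb|exists i].
split=> [u v|a v a0].
  rewrite -lerBlDr; apply: lb_le_inf => // _ [i Di <-].
  rewrite lerBlDr -lerBlDl; apply: lb_le_inf => // _ [j Dj <-].
  rewrite lerBlDl; have [k Dk] := FD i j u v Di Dj.
  exact/le_trans/infle.
rewrite -ler_pdivrMl//; apply: lb_le_inf => // _ [i Di <-].
rewrite ler_pdivrMl//; have [k Dk] := FZ i a v Di a0.
exact/le_trans/infle.
Qed.

(** Pushing [p] down along the direction [x] as far as sublinearity allows:
    the resulting functional has value at most [- p x] at [- x]. *)
Let push p x v := inf [set p (v + t *: x) - t * p x | t in [set t | 0 <= t]].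

Let push_lb p x v t : sublinear p -> 0 <= t ->
  - p (- v) <= p (v + t *: x) - t * p x.
Proof.
move=> sp t0; have := sp.1 (v + t *: x) (- v).
rewrite addrC addKr sublinear_scale_ge0//; lra.
Qed.

Let push_sublinear p x : sublinear p -> sublinear (push p x).
Proof.
move=> sp; apply: inf_sublinear => [|v|s t u v s0 t0|t a v t0 a0].
- by exists 0 => /=.
- by exists (- p (- v)) => t t0; exact: push_lb.
- exists (s + t) => /=; first exact: addr_ge0.
  by rewrite scalerDl addrACA mulrDl; have := sp.1 (u + s *: x) (v + t *: x); lra.
- exists (a * t) => /=; first by rewrite mulr_ge0// ltW.
  by rewrite -scalerA -scalerDr sublinear_scale// mulrBr mulrA.
Qed.

Let push_le p x v t : sublinear p -> 0 <= t ->
  push p x v <= p (v + t *: x) - t * p x.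
Proof.
move=> sp t0; apply: ge_inf; last by exists t.
by exists (- p (- v)) => _ [s s0 <-]; exact: push_lb.
Qed.

Let push_le0 p x v : sublinear p -> push p x v <= p v.
Proof. by move=> /(@push_le p x v 0)/(_ (lexx _)); rewrite scale0r addr0 mul0r subr0. Qed.

Let push_opp p x : sublinear p -> push p x (- x) <= - p x.
Proof.
move=> sp; have := push_le x (- x) sp ler01.
by rewrite scale1r addNr sublinear0// sub0r mul1r.
Qed.

Let minimal_sublinear p : sublinear p ->
  exists2 q, sublinear q /\ (forall v, q v <= p v) &
    forall r, sublinear r -> (forall v, r v <= q v) -> forall v, r v = q v.
Proof.
move=> sp; pose T := {q : V -> R | sublinear q /\ forall v, q v <= p v}.
pose ge (q r : T) := `[< forall v, sval r v <= sval q v >].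
have [//| | |A totA|q qmin] := @Zorn T ge.
- by move=> q; apply/asboolP.
- move=> q r s /asboolP rq /asboolP sr; apply/asboolP => v.
  exact: le_trans (sr v) (rq v).
- move=> [q hq] [r hr] /asboolP/= rq /asboolP/= qr; apply: eq_exist.
  by apply/funext => v; apply/eqP; rewrite eq_le qr rq.
- (* [p] itself is put in the chain, so that the infimum is over a nonempty
     family even when [A] is empty. *)
  pose B q := q = p \/ exists2 r, A r & q = sval r.
  have Bp q : B q -> sublinear q /\ forall v, q v <= p v.
    by move=> [->|[[r hr] _ ->]]//=; split.
  have lb v q : B q -> - p (- v) <= q v.
    move=> /Bp[sq qp]; rewrite (le_trans _ (sublinear_opp v sq))//.
    by rewrite lerN2.
  have totB q r : B q -> B r -> (forall v, q v <= r v) \/ (forall v, r v <= q v).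
    move=> [->|[q' Aq ->]] Br; first by right; case: (Bp _ Br).
    case: Br => [->|[r' Ar ->]]; first by left; case: (svalP q').
    by have [/asboolP|/asboolP] := totA _ _ Aq Ar; [right|left].
  pose m v := inf [set q v | q in B].
  have sm : sublinear m.
    apply: inf_sublinear => [|v|q r u v Bq Br|q a v Bq a0].
    + by exists p; left.
    + by exists (- p (- v)) => q /lb.
    + have [qr|rq] := totB q r Bq Br.
        by exists q => //; rewrite (le_trans ((Bp _ Bq).1.1 u v))// lerD2l.
      by exists r => //; rewrite (le_trans ((Bp _ Br).1.1 u v))// lerD2r.
    + by exists q => //; exact: (Bp _ Bq).1.2.
  have mle v q : B q -> m v <= q v.
    move=> Bq; apply: ge_inf; last by exists q.
    by exists (- p (- v)) => _ [r /lb + <-]; exact.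
  have mp v : m v <= p v by apply: mle; left.
  exists (exist _ m (conj sm mp)) => r Ar; apply/asboolP => v /=.
  by apply: mle; right; exists r.
- exists (sval q); first exact: (svalP q).
  move=> r sr rq v.
  have hr : sublinear r /\ forall v, r v <= p v.
    by split=> // w; exact: le_trans (rq w) ((svalP q).2 w).
  by have <- : exist _ r hr = q :> T by apply: qmin; apply/asboolP.
Qed.

(** Minimal sublinear functionals are linear, since pushing one down along [x]
    leaves it unchanged and so it is odd. Pushing [p] down along [x0] beforehand
    makes the linear functional agree with [p] at [x0]. *)
Theorem hahn_banach p x0 : sublinear p ->
  exists2 f : {scalar V}, (forall v, f v <= p v) & f x0 = p x0.
Proof.
move=> sp; have spx := push_sublinear x0 sp.
have [q [sq qp] qmin] := minimal_sublinear spx.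
have qN v : q (- v) = - q v.
  apply/eqP; rewrite eq_le; apply/andP; split.
    rewrite -(qmin _ (push_sublinear v sq)) => [|u]; first exact: push_opp.
    exact: push_le0.
  by have := sublinear_opp (- v) sq; rewrite opprK.
have qD u v : q (u + v) = q u + q v.
  apply/eqP; rewrite eq_le sq.1/= -lerBrDr -qN.
  by rewrite -[leLHS](congr1 q (addrK v u)) sq.1.
have qZ a v : q (a *: v) = a * q v.
  have [a0|a0] := leP 0 a; first exact: sublinear_scale_ge0.
  have := @sublinear_scale q (- a) v sq; rewrite oppr_gt0 scaleNr qN mulNr.
  by move=> /(_ a0)/oppr_inj.
have ql : scalar q by move=> a u v; rewrite qD qZ.
pose f : {scalar V} := HB.pack q (GRing.isLinear.Build R V R *%R q ql).
have fp v : f v <= p v by rewrite (le_trans (qp v))// push_le0.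
exists f => //; apply/eqP; rewrite eq_le fp/= -lerN2.
have -> : - f x0 = q (- x0) by rewrite qN.
exact: le_trans (qp _) (push_opp _ sp).
Qed.

End sublinear.

(** * Norms of functionals *)

Section dual_norm.
Context {R : realType} {Z : normedModType R}.
Implicit Types f g : dual Z.

Lemma dualD f g z : (f + g) z = f z + g z. Proof. by []. Qed.

Lemma dualB f g z : (f - g) z = f z - g z. Proof. by []. Qed.

Lemma dualZ a f z : (a *: f) z = a * f z. Proof. by []. Qed.

Lemma dual_sum (I : Type) (r : seq I) (F : I -> dual Z) z :
  (\sum_(i <- r) F i) z = \sum_(i <- r) F i z.
Proof. by elim/big_ind2 : _ => // f a g b <- <-. Qed.

Let has_ubound_dual f : has_ubound [set `|f z| | z in unit_ball Z].
Proof.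
have /linear_bounded_continuous/bounded_funP/(_ 1)[M fM] :=
  @dual_continuous R Z f.
by exists M => _ [z z1 <-]; exact: fM.
Qed.

Lemma dual_norm_ge f z : `|z| <= 1 -> `|f z| <= `|f|.
Proof.
by move=> z1; rewrite dual_normE; apply: ub_le_sup => //; exists z.
Qed.

Lemma dual_le f z : f z <= `|f| * `|z|.
Proof.
have [->|z0] := eqVneq z 0; first by rewrite linear0 normr0 mulr0.
have nz : 0 < `|z| by rewrite normr_gt0.
rewrite -ler_pdivrMr// mulrC.
have := @dual_norm_ge f (`|z|^-1 *: z); rewrite normfZV// => /(_ (lexx _)).
by rewrite linearZ/=; apply: le_trans; rewrite ler_norm.
Qed.

Lemma dual_ball_le f z : `|f| <= 1 -> f z <= `|z|.
Proof.
by move=> f1; rewrite (le_trans (dual_le f z))// ler_piMl.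
Qed.

Lemma dual_norm_le f M : (forall z, `|z| <= 1 -> f z <= M) -> `|f| <= M.
Proof.
move=> fM; rewrite dual_normE; apply: ge_sup.
  by exists `|f 0|, 0 => //=; rewrite /unit_ball/= normr0.
move=> _ [z z1 <-]; rewrite ler_norml fM// andbT lerNl -linearN fM//.
by rewrite normrN.
Qed.

Lemma dual_norm_approx f d : 0 < d -> exists2 z, `|z| <= 1 & `|f| - d < f z.
Proof.
move=> d0; apply: contrapT => nf; suff : `|f| <= `|f| - d by lra.
apply: dual_norm_le => z z1; rewrite leNgt; apply/negP => fz.
by apply: nf; exists z.
Qed.

Lemma dual_supE f : sup [set f u | u in unit_ball Z] = `|f|.
Proof.
have ub : ubound [set f u | u in unit_ball Z] `|f|.
  by move=> _ [z z1 <-]; rewrite (le_trans (ler_norm _))// dual_norm_ge.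
apply/eqP; rewrite eq_le; apply/andP; split.
  by apply: ge_sup => //; exists (f 0), 0 => //=; rewrite /unit_ball/= normr0.
apply: dual_norm_le => z z1; apply: ub_le_sup; first by exists `|f|.
by exists z.
Qed.

Lemma dual_of_linear (f : {scalar Z}) c : 0 <= c ->
  (forall z, f z <= c * `|z|) -> exists2 g : dual Z, (forall z, g z = f z) & `|g| <= c.
Proof.
move=> c0 fc.
have cf : continuous f.
  apply/linear_bounded_continuous/bounded_funP => r; exists (c * r) => z zr.
  rewrite ler_norml -[- _ <= _]lerN2 opprK -linearN.
  by apply/andP; split; rewrite (le_trans (fc _))// ?normrN ler_wpM2l.
have lf : scalar f by move=> a u v; rewrite linearP.
exists (Dual (mem_set (conj lf cf))) => //; apply: dual_norm_le => z z1 /=.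
by rewrite (le_trans (fc _))// ler_piMr.
Qed.

Lemma norming_functional z : exists2 f : dual Z, `|f| <= 1 & f z = `|z|.
Proof.
have sn : sublinear (fun v : Z => `|v|).
  split=> [u v|a v a0]; first exact: ler_normD.
  by rewrite normrZ gtr0_norm.
have [f fn fz] := hahn_banach z sn.
have [|g gf g1] := @dual_of_linear f 1 ler01.
  by move=> v; rewrite mul1r.
by exists g => //; rewrite gf fz.
Qed.

Lemma wstar_supE z : sup [set g z | g in unit_ball (dual Z)] = `|z|.
Proof.
have ub : ubound [set g z | g in unit_ball (dual Z)] `|z|.
  by move=> _ [g g1 <-]; exact: dual_ball_le.
have [f f1 fz] := norming_functional z.
apply/eqP; rewrite eq_le; apply/andP; split.
  by apply: ge_sup => //; exists (f z), f.
by rewrite -fz; apply: ub_le_sup; [exists (`|z|)|exists f].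
Qed.

End dual_norm.

Section isometry.
Context {R : realType} {Z W : normedModType R}.
Variable J : {linear Z -> W}.
Hypothesis J_isometry : forall z, `|J z| = `|z|.

Let restr_linear (f : dual W) : scalar (f \o J).
Proof. by move=> a u v /=; rewrite !linearP. Qed.

Let restr_continuous (f : dual W) : continuous (f \o J).
Proof.
move=> z; apply: continuous_comp; last exact: dual_continuous.
apply/bounded_linear_continuous/bounded_funP => r; exists r => u.
by rewrite J_isometry.
Qed.

Definition restr (f : dual W) : dual Z :=
  Dual (mem_set (conj (restr_linear f) (@restr_continuous f))).

Lemma restrE f z : restr f z = f (J z). Proof. by []. Qed.

Lemma restr_norm_le f : `|restr f| <= `|f|.
Proof.
apply: dual_norm_le => z z1; rewrite restrE (le_trans (dual_le _ _))//.
by rewrite J_isometry ler_piMr.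
Qed.

(** The extension is any linear functional below the largest sublinear one that is
    at most [g] on [Z] and at most [`|g| * `|w|] everywhere. *)
Lemma norm_preserving_extension (g : dual Z) :
  exists2 f : dual W, restr f = g & `|f| <= `|g|.
Proof.
pose F z w := g z + `|g| * `|w - J z|.
have gge z : - (`|g| * `|z|) <= g z by rewrite lerNl -linearN -[`|z|]normrN dual_le.
have lb z w : - (`|g| * `|w|) <= F z w.
  have : `|z| <= `|w| + `|w - J z|.
    rewrite -J_isometry -[J z in leLHS](subKr w).
    by rewrite (le_trans (ler_normB _ _))// subKr.
  move=> /(ler_wpM2l (normr_ge0 g)); have := gge z; rewrite /F mulrDr; lra.
have sp : sublinear (fun w => inf [set F z w | z in [set: Z]]).
  apply: inf_sublinear => [|w|y z u v _ _|z a v _ a0].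
  - by exists 0.
  - by exists (- (`|g| * `|w|)).
  - exists (y + z) => //; rewrite /F linearD/= addrACA lerD2l -mulrDr.
    rewrite ler_wpM2l// linearD opprD addrACA; exact: ler_normD.
  - exists (a *: z) => //; rewrite /F [J _]linearZ linearZ -scalerBr normrZ gtr0_norm//.
    by rewrite mulrDr mulrCA.
have pF z w : inf [set F z w | z in [set: Z]] <= F z w.
  by apply: ge_inf; [exists (- (`|g| * `|w|)) => _ [y _ <-]|exists z].
have [f fp _] := hahn_banach 0 sp.
have [|h hf hg] := @dual_of_linear _ _ f `|g| (normr_ge0 _).
  move=> w; rewrite (le_trans (fp w))// (le_trans (pF 0 w))//.
  by rewrite /F (linear0 J) (linear0 g) add0r subr0.
have hle z : h (J z) <= g z.
  by rewrite hf (le_trans (fp _))// (le_trans (pF z _))// /F subrr normr0 mulr0 addr0.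
exists h => //; apply/val_inj/funext => z /=.
apply/eqP; rewrite eq_le hle/= -lerN2.
by have := hle (- z); rewrite !linearN.
Qed.

End isometry.

(** * Intersection of balls in M-ideals *)

(** The form in which the M-ideal property is used. The ball around [0] puts
    the common point itself in (almost) the unit ball of [Z], as the transfer of
    weakly open sets requires. *)
Definition ball_property {R : realType} {Z W : normedModType R} (J : Z -> W) :=
  forall (w : W) (ys : seq Z) (e : R), `|w| <= 1 ->
    (forall y, y \in ys -> `|y| <= 1) -> 0 < e ->
  exists2 z, `|z| <= 1 + e & forall y, y \in ys -> `|w + J y - J z| <= 1 + e.

(** Suppose that the balls of radius [1 + e] around [0] and the [x + y_i] have no
    common point in [Y]. The point [w0] of a finite power of [X] with coordinates
    [0] and [x + y_i] is then at distance more than [1] from the diagonal of [Y],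
    and a separating functional is a tuple [phi] with [\sum_i `|phi i| <= 1] and
    [\sum_i phi i] in the annihilator of [Y], that is [\sum_i P (phi i) = 0].
    The L-projection splits each [`|phi i|] into a part that controls [x] and a
    part that controls [y_i], so that [phi] is at most [1] at [w0]. *)
Theorem M_ideal_ball_property {R : realType} {X : normedModType R}
    (Y : submodClosed X) :
  M_ideal Y -> ball_property (\val : subnormed Y -> X).
Proof.
move=> [_ [P [[PP PL] kerP]]] x ys e x1 ys1 e0.
pose I := 'I_(size ys).+1.
pose y (i : I) : subnormed Y := nth 0 ys i.-1.
have y1 i : i != ord0 -> `|y i| <= 1.
  case: i => -[|i] ilt// _; apply: ys1; rewrite mem_nth//.
pose w0 (i : I) : X := if i == ord0 then 0 else x + \val (y i).
pose N (v : I -> X) : R := \big[Num.max/0]_i `|v i|.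
have N_ge v i : `|v i| <= N v by exact: le_bigmax.
have N_le v M : 0 <= M -> (forall i, `|v i| <= M) -> N v <= M.
  by move=> M0 vM; apply: bigmax_le.
have N_ge0 v : 0 <= N v := le_trans (normr_ge0 _) (N_ge v ord0).
pose F (z : subnormed Y) v := N (fun i => v i - \val z).
pose p v := inf [set F z v | z in [set: subnormed Y]].
have pF z v : p v <= F z v.
  by apply: ge_inf; [exists 0 => _ [u _ <-]; exact: N_ge0|exists z].
have sp : sublinear p.
  apply: inf_sublinear => [|v|z z' u v _ _|z a v _ a0].
  - by exists 0.
  - by exists 0 => z _; exact: N_ge0.
  - exists (z + z') => //; apply: N_le => [|i]; first by rewrite addr_ge0 ?N_ge0.
    rewrite [\val (z + z')]raddfD opprD [_ i]/(u i + v i) addrACA (le_trans (ler_normD _ _))//.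
    by apply: lerD; [exact: (N_ge (fun i => u i - \val z))|
                     exact: (N_ge (fun i => v i - \val z'))].
  - exists (a *: z) => //; apply: N_le => [|i].
      by rewrite mulr_ge0 ?N_ge0 ?ltW.
    rewrite [\val (a *: z)]linearZ [_ i]/(a *: v i) -scalerBr normrZ gtr0_norm//.
    rewrite ler_wpM2l ?(ltW a0)//.
    exact: (N_ge (fun i => v i - \val z)).
(* [p w0] is the distance from [w0] to the diagonal of [Y]. *)
suff pw0 : p w0 <= 1.
  have [|_ [z _ <-] Fz] := @inf_adherent _ [set F z w0 | z in setT] _ e0.
    split; first by exists (F 0 w0), 0.
    by exists 0 => _ [u _ <-]; exact: N_ge0.
  have zw i : `|w0 i - \val z| <= 1 + e.
    rewrite (le_trans (N_ge (fun i => w0 i - \val z) i))// (le_trans (ltW Fz))//.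
    by rewrite lerD2r.
  exists z; first by have := zw ord0; rewrite /w0 eqxx sub0r normrN.
  move=> u uys; have ilt : ((index u ys).+1 < (size ys).+1)%N.
    by rewrite ltnS index_mem.
  by have := zw (Ordinal ilt); rewrite /w0/= /y/= nth_index.
have [f fp <-] := hahn_banach w0 sp.
have fN v : f v <= N v.
  rewrite (le_trans (fp v))// (le_trans (pF 0 v))//; apply: N_le => // i.
  by rewrite [\val (0 : subnormed Y)]raddf0 subr0.
pose single (i : I) (u : X) : I -> X := fun j => if j == i then u else 0.
have [phi phiE] : exists phi : I -> dual X, forall i u, phi i u = f (single i u).
  suff : forall i, exists g : dual X, forall u, g u = f (single i u).
    by move=> /choice[h hE]; exists h.
  move=> i; have lg : scalar (f \o single i).
    move=> a u v /=; rewrite -linearP; congr (f _); apply/funext => j.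
    rewrite /single [RHS]/(a *: (if j == i then u else 0) + if j == i then v else 0).
    by case: ifP => // _; rewrite -[RHS]/(a *: 0 + 0) scaler0 addr0.
  pose g : {scalar X} := HB.pack (f \o single i) (GRing.isLinear.Build R X R *%R _ lg).
  have [|h hg _] := @dual_of_linear _ _ g 1 ler01; last by exists h.
  move=> u; rewrite mul1r (le_trans (fN _))//; apply: N_le => // j.
  by rewrite /single; case: ifP => //; rewrite normr0.
have fE v : f v = \sum_i phi i (v i).
  under eq_bigr do rewrite phiE; rewrite -linear_sum; congr (f _).
  apply/funext => j; rewrite fct_sumE (bigD1 j)//= big1 ?addr0 /single ?eqxx//.
  by move=> i ij; rewrite eq_sym (negbTE ij).
have sumP0 : \sum_i P (phi i) = 0.
  rewrite -linear_sum; suff : annihilator Y (\sum_i phi i) by rewrite -kerP.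
  have cle (u : subnormed Y) : f (fun=> \val u) <= 0.
    rewrite (le_trans (fp _))// (le_trans (pF u _))//; apply: N_le => // i.
    by rewrite subrr normr0.
  move=> u uY; rewrite dual_sum -(fE (fun=> u)); apply/eqP; rewrite eq_le.
  rewrite (cle (SubNormed uY))/= -lerN2 oppr0 -linearN.
  have := cle (- SubNormed uY); rewrite raddfN/=; exact.
have sum_norm : \sum_i `|phi i| <= 1.
  apply/ler_addgt0Pr => d d0; pose m : R := (size ys).+1%:R.
  have m0 : 0 < m by rewrite ltr0n.
  have dm0 : 0 < d / m by rewrite divr_gt0.
  have [v v1 vphi] : exists2 v : I -> X, (forall i, `|v i| <= 1) &
      forall i, `|phi i| - d / m < phi i (v i).
    suff /choice[v hv] : forall i, exists u, `|u| <= 1 /\ `|phi i| - d / m < phi i u.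
      by exists v => i; have [] := hv i.
    by move=> i; have [u u1 hu] := dual_norm_approx (phi i) dm0; exists u.
  rewrite -lerBlDr (@le_trans _ _ (f v))//; last first.
    by rewrite (le_trans (fN v))//; exact: N_le.
  rewrite fE (@le_trans _ _ (\sum_i (`|phi i| - d / m)))//; last first.
    by apply: ler_sum => i _; exact/ltW/vphi.
  rewrite sumrB sumr_const card_ord -[(d / m) *+ _]mulr_natr divfK//.
  by rewrite gt_eqF.
have PfE (g : dual X) : g x = P g x + (g - P g) x by rewrite dualB addrC subrK.
have Pann (g : dual X) u : u \in Y -> (g - P g) u = 0.
  have : (annihilator Y) (g - P g) by rewrite -kerP /= linearB PP subrr.
  exact.
have term i : phi i (w0 i) <= P (phi i) x + `|phi i|.
  have Px (g : dual X) : - `|P g| <= P g x.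
    have := dual_norm_ge (P g) x1; rewrite ler_norml => /andP[-> //].
  rewrite PL /w0; case: ifPn => [_|i0].
    by rewrite linear0; have := Px (phi i); have := normr_ge0 (phi i - P (phi i)); lra.
  rewrite [phi i _]linearD/= (PfE (phi i)) -addrA lerD2l [leRHS]addrC lerD//.
    by rewrite (le_trans (ler_norm _))// dual_norm_ge.
  have := Pann (phi i) _ (valP (y i)); rewrite dualB => /eqP; rewrite subr_eq0 => /eqP ->.
  by rewrite (le_trans (ler_norm _))// dual_norm_ge// y1.
rewrite fE (le_trans (ler_sum _ (fun i _ => term i)))// big_split/=.
by rewrite -dual_sum sumP0 add0r.
Qed.

(** * Partitions of unity *)

(** Urysohn functions [h t] equal to [1] at [t] and supported in [U t] exceed
    [1/2] on open sets that cover [K]; a finite subcover makes their sum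
    bounded away from zero, so that it can be divided out. *)
Lemma partition_of_unity {R : realType} {K : topologicalType}
    (U : K -> set K) :
  compact [set: K] -> hausdorff_space K -> (forall t, open (U t) /\ U t t) ->
  exists (ts : seq K) (h : K -> K -> R),
    [/\ forall t, continuous (h t), forall t s, 0 <= h t s,
        forall t s, h t s != 0 -> U t s & forall s, \sum_(t <- ts) h t s = 1].
Proof.
move=> cK hK oU; have nK := compact_normal hK cK.
have [h hP] : exists h : K -> K -> R, forall t,
    [/\ continuous (h t), forall s, 0 <= h t s, h t t = 1 &
        forall s, h t s != 0 -> U t s].
  suff /choice[h hP] : forall t, exists h : K -> R,
      [/\ continuous h, forall s, 0 <= h s, h t = 1 & forall s, h s != 0 -> U t s].
    by exists h.
  move=> t; have [oUt Utt] := oU t.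
  have cUt : closed (~` U t) by exact: open_closedC.
  have ct : closed [set t].
    exact/accessible_closed_set1/hausdorff_accessible.
  have disj : ~` U t `&` [set t] = set0.
    by apply/seteqP; split=> // s [/= nUs st]; apply: nUs; rewrite st.
  have [f [cf f0 f1 f01]] := @urysohn_ext_itv K R nK _ _ 0 1 cUt ct disj ltr01.
  exists f; split=> // [s||s].
  - by have /f01 : range f (f s) by []; rewrite /= in_itv/= => /andP[].
  - by apply: f1; exists t.
  - by apply: contraNP => nUs; apply/eqP/f0; exists s.
pose V t := h t @^-1` [set r | 2^-1 < r].
have oV t : open (V t) by apply: open_comp; [move=> s _; have [] := hP t|exact: open_gt].
have [ts uts cov] : exists2 ts : seq K, uniq ts & forall s, exists2 t, t \in ts & V t s.
  have [[t0 _]|K0] := pselect ([set: K] !=set0); last first.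
    by exists [::] => // s; exfalso; apply: K0; exists s.
  pose K' : ptopologicalType := HB.pack K (isPointed.Build K t0).
  have := cK; rewrite [compact _](congr1 (@^~ setT) (@compact_cover K')).
  move=> /(_ _ setT V (fun t _ => oV t))[t _|ts _ cov]; last first.
    exists (finmap.enum_fset ts) => [|s]; first exact: finmap.fset_uniq.
    by have [t] := cov s Logic.I; exists t.
  exists t => //; rewrite /V/=; have [_ _ -> _] := hP t.
  by rewrite invf_lt1// ltr1n.
pose H s := \sum_(t <- ts) h t s.
have H0 s : 0 < H s.
  have [t tts Vts] := cov s.
  rewrite /H (bigD1_seq t)//= ltr_pwDl//.
    by rewrite (lt_trans _ Vts)// invr_gt0.
  by apply: sumr_ge0 => i _; have [_ + _ _] := hP i; exact.
have cH : continuous H.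
  by apply: continuous_big => [|t _]; [exact: add_continuous|have [] := hP t].
exists ts, (fun t s => h t s / H s); split=> [t s|t s|t s|s].
- apply: cvgM; first by have [+ _ _ _] := hP t; exact.
  by apply: cvgV; [rewrite gt_eqF ?H0|exact: cH].
- by rewrite mulr_ge0 ?invr_ge0 ?(ltW (H0 s))//; have [_ + _ _] := hP t; exact.
- by rewrite mulf_eq0 negb_or => /andP[+ _]; have [_ _ _] := hP t; exact.
- by rewrite -mulr_suml divff// gt_eqF// H0.
Qed.

(** * Spaces of continuous functions *)

Section contfun.
Context {R : realType} {K : topologicalType} (cK : compact [set: K]).

Lemma contfunD {Z : normedModType R} (f g : contfun cK Z) t :
  (f + g) t = f t + g t. Proof. by []. Qed.

Lemma contfunB {Z : normedModType R} (f g : contfun cK Z) t :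
  (f - g) t = f t - g t. Proof. by []. Qed.

Lemma contfun_norm_ge {Z : normedModType R} (f : contfun cK Z) t : `|f t| <= `|f|.
Proof.
have cf : {within [set: K], continuous (f : K -> Z)}.
  by apply: continuous_subspaceT; exact: contfun_continuous.
have [M [_ fM]] := compact_bounded (continuous_compact cf cK).
rewrite contfun_normE; apply: ub_le_sup; last by exists t.
exists (M + 1) => _ [s _ <-]; apply: (fM (M + 1)); first by rewrite ltrDl.
by exists s.
Qed.

Lemma contfun_norm_le {Z : normedModType R} (f : contfun cK Z) M : 0 <= M ->
  (forall t, `|f t| <= M) -> `|f| <= M.
Proof.
move=> M0 fM; rewrite contfun_normE.
have [ne|/nonemptyPn->] := pselect ([set `|f t| | t in [set: K]] !=set0).
  by apply: ge_sup => // _ [t _ <-].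
by rewrite sup0.
Qed.

Section composition.
Context {Z W : normedModType R} (J : {linear Z -> W}).
Hypothesis J_isometry : forall z, `|J z| = `|z|.

Let comp_continuous (g : contfun cK Z) : continuous (J \o g).
Proof.
move=> t; apply: continuous_comp; first exact: contfun_continuous.
apply/bounded_linear_continuous/bounded_funP => r; exists r => u.
by rewrite J_isometry.
Qed.

Definition contfun_comp (g : contfun cK Z) : contfun cK W :=
  ContFun cK (mem_set (@comp_continuous g)).

Lemma contfun_compE g t : contfun_comp g t = J (g t). Proof. by []. Qed.

Lemma contfun_comp_isometry g : `|contfun_comp g| = `|g|.
Proof.
apply/eqP; rewrite eq_le; apply/andP; split; apply: contfun_norm_le => // t.
  by rewrite contfun_compE J_isometry contfun_norm_ge.
by rewrite -J_isometry -contfun_compE contfun_norm_ge.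
Qed.

Lemma contfun_comp_linear : linear contfun_comp.
Proof. by move=> a f g; apply/val_inj/funext => t; exact: linearP. Qed.

HB.instance Definition _ := GRing.isLinear.Build R (contfun cK Z)
  (contfun cK W) *:%R contfun_comp contfun_comp_linear.

(** The balls in question have a common point in [Z] at each [t], and this
    point still works, with a slightly larger radius, near [t]. Balls being
    convex, a partition of unity glues these local choices. *)
Lemma ball_property_contfun : hausdorff_space K ->
  ball_property J -> ball_property contfun_comp.
Proof.
move=> hK bJ f ys e f1 ys1 e0; have e20 : 0 < e / 2 by lra.
have [z z1 zP] : exists2 z : K -> Z, (forall t, `|z t| <= 1 + e / 2) &
    forall t y, y \in ys -> `|f t + J (y t) - J (z t)| <= 1 + e / 2.
  suff /choice[z zP] : forall t, exists z, `|z| <= 1 + e / 2 /\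
      forall y, y \in ys -> `|f t + J (y t) - J z| <= 1 + e / 2.
    by exists z => t; have [] := zP t.
  move=> t; have [||z z1 zP] := bJ (f t) [seq y t | y : contfun cK Z <- ys] _ _ _ e20.
  - exact: le_trans (contfun_norm_ge _ _) f1.
  - by move=> _ /mapP[y yys ->]; rewrite (le_trans (contfun_norm_ge _ _))// ys1.
  - by exists z; split=> // y yys; apply: zP; apply/mapP; exists y.
pose U t := [set s | forall y, y \in ys -> `|f s + J (y s) - J (z t)| < 1 + e].
have oU t : open (U t) /\ U t t.
  split; last by move=> y yys; rewrite (le_lt_trans (zP t y yys))//; lra.
  pose d (y : contfun cK Z) s := `|(f + contfun_comp y) s - J (z t)|.
  have -> : U t = \bigcap_(y in [set` ys]) d y @^-1` [set r | r < 1 + e].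
    by apply/seteqP; split => s.
  rewrite bigcap_seq; elim/big_ind : _ => [|A B|y _]; [exact: openT|exact: openI|].
  apply: open_comp; last exact: open_lt.
  move=> s _; apply: cvg_norm; apply: cvgB; last exact: cvg_cst.
  exact: contfun_continuous.
have [ts [h [ch h0 hU h1]]] := @partition_of_unity R K U cK hK oU.
have cg : continuous (fun s => \sum_(t <- ts) h t s *: z t).
  apply: continuous_big => [|t _ s]; first exact: add_continuous.
  by apply: cvgZr_tmp; exact: ch.
pose g : contfun cK Z := ContFun cK (mem_set cg).
have hle (v : K -> W) M s : (forall t, h t s != 0 -> `|v t| <= M) ->
    `|\sum_(t <- ts) h t s *: v t| <= M.
  move=> vM; rewrite (le_trans (ler_norm_sum _ _ _))//.
  rewrite -[leRHS]mul1r -(h1 s) mulr_suml ler_sum// => t _.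
  rewrite normrZ ger0_norm//; have [->|ht] := eqVneq (h t s) 0.
    by rewrite !mul0r.
  by rewrite ler_wpM2l// vM.
have Jg s : J (g s) = \sum_(t <- ts) h t s *: J (z t).
  by rewrite /g/= linear_sum; apply: eq_bigr => t _; rewrite linearZ.
have e10 : 0 <= 1 + e by lra.
exists g.
  apply: contfun_norm_le => // s; rewrite -J_isometry Jg; apply: hle => t _.
  by rewrite J_isometry (le_trans (z1 t))//; lra.
move=> y yys; apply: contfun_norm_le => // s.
rewrite contfunB contfunD !contfun_compE Jg.
rewrite -[f s + _]scale1r -[X in X *: _](h1 s) scaler_suml -sumrB.
under eq_bigr do rewrite -scalerBr.
by apply: hle => t /hU /(_ y yys)/ltW.
Qed.

End composition.
End contfun.

(** * Diameters and basic neighbourhoods *)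

Section diameter.
Context {R : realType}.

Lemma diameter_eq2 {Z : normedModType R} (A : set Z) : A `<=` unit_ball Z ->
  diameter A = 2%:E <->
  forall e, 0 < e -> exists a b, [/\ A a, A b & 2 - e < `|a - b|].
Proof.
move=> A1; split=> [dA e e0|far].
  apply: contrapT => nfar.
  suff : (diameter A <= (2 - e)%:E)%E by rewrite dA lee_fin; lra.
  apply: ge_ereal_sup => _ [a Aa [b Ab <-]]; rewrite lee_fin leNgt.
  by apply/negP => ab; apply: nfar; exists a, b.
apply/eqP; rewrite eq_le; apply/andP; split.
  apply: ge_ereal_sup => _ [a Aa [b Ab <-]]; rewrite lee_fin.
  by rewrite (le_trans (ler_normB _ _))// (_ : 2 = 1 + 1)// lerD// A1.
apply/lee_subgt0Pr => e e0; have [a [b [Aa Ab ab]]] := far _ e0.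
rewrite (@le_trans _ _ `|a - b|%:E)//; first by rewrite -EFinB lee_fin ltW.
by apply: ereal_sup_ubound; exists a => //; exists b.
Qed.

Lemma common_lower_bound {T : eqType} (s : seq T) (h : T -> R) :
  (forall x, 0 < h x) -> exists2 d, 0 < d & forall x, x \in s -> d <= h x.
Proof.
move=> h0; elim: s => [|x s [d d0 dh]]; first by exists 1.
exists (Num.min d (h x)); first by rewrite lt_min d0 h0.
move=> y; rewrite inE => /predU1P[->|ys]; first by rewrite ge_min lexx orbT.
by rewrite ge_min dh.
Qed.

End diameter.

(** The weak and the weak-star topologies are both initial for a map [F] into a
    space of functions with pointwise convergence. *)
Section initial_ptws.
Context {R : realType} {S I : choiceType} (F : S -> {ptws I -> R}).
Implicit Types (s : S) (x : I).

Lemma initial_ptws_basis (U : set (initial_topology F)) s : open U -> U s ->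
  exists (xs : seq I) (d : R), 0 < d /\
    forall s', (forall x, x \in xs -> `|F s' x - F s x| < d) -> U s'.
Proof.
move=> [A oA <-] /= As.
pose basic (xs : seq I) (d : R) := [set g : I -> R | forall x, x \in xs -> `|g x - F s x| < d].
pose G := filter_from [set p : seq I * R | 0 < p.2] (fun p => basic p.1 p.2).
have FG : Filter G.
  apply: filter_from_filter; first by exists ([::], 1) => /=.
  move=> [xs d] [ys d'] /= d0 d'0; exists (xs ++ ys, Num.min d d').
    by rewrite /= lt_min d0.
  move=> g /= gb; split=> x xin; have := gb x; rewrite mem_cat xin ?orbT lt_min.
    by move=> /(_ isT)/andP[].
  by move=> /(_ isT)/andP[].
have GF : {ptws, G --> F s}.
  apply/cvg_sup => x B [_ [[C oC <-] /= Cs]] /filterS; apply.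
  have [e /= e0 eC] := open_nbhs_nbhs (conj oC Cs).
  exists ([:: x], e) => // g /(_ x); rewrite mem_head => /(_ isT) gx.
  by apply: eC; rewrite /= distrC.
have [[xs d] /= d0 sub] : G A by apply: GF; exact: open_nbhs_nbhs.
by exists xs, d; split=> // s' s'd; exact: sub.
Qed.

Lemma initial_ptws_open (xs : seq I) (g : I -> R) d :
  open ([set s | forall x, x \in xs -> `|F s x - g x| < d] : set (initial_topology F)).
Proof.
have -> : [set s | forall x, x \in xs -> `|F s x - g x| < d] =
    \bigcap_(x in [set` xs]) [set s | `|F s x - g x| < d].
  by apply/seteqP; split.
rewrite bigcap_seq; elim/big_ind : _ => [|A B|x _]; [exact: openT|exact: openI|].
exists [set h | `|h x - g x| < d] => //.
apply: (@open_comp _ _ (fun h : {ptws I -> R} => h x)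
  [set r : R | `|r - g x| < d]).
  by move=> h _; exact: (@proj_continuous _ (fun=> R) x h).
have -> : [set r : R | `|r - g x| < d] = ball (g x) d.
  by apply/seteqP; split=> r /=; rewrite /ball/= distrC.
exact: ball_open.
Qed.

End initial_ptws.

(** * Combinations of slices with fixed weights *)

Section combination.
Context {R : realType} {n : nat} (l : 'I_n -> R).

Definition combination {Z : normedModType R} (S : 'I_n -> set Z) : set Z :=
  [set \sum_(i < n) l i *: s i | s in [set s | forall i, S i (s i)]].

(** The common form of the Slice and the Strong diameter two properties: for one
    weight it is the former, for all weights together it is the latter. *)
Definition combinations_have_diameter2 {Z : normedModType R}
    (isS : set Z -> Prop) : Prop :=
  forall S : 'I_n -> set Z, (forall i, isS (S i)) -> diameter (combination S) = 2%:E.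

Definition convex_weights := (forall i, 0 <= l i) /\ \sum_(i < n) l i = 1.

Lemma convex_weights_norm_le {Z : normedModType R} (s : 'I_n -> Z) M :
  convex_weights -> (forall i, `|s i| <= M) -> `|\sum_(i < n) l i *: s i| <= M.
Proof.
move=> [l0 l1] sM; rewrite (le_trans (ler_norm_sum _ _ _))//.
rewrite -[leRHS]mul1r -l1 mulr_suml ler_sum// => i _.
by rewrite normrZ ger0_norm// ler_wpM2l.
Qed.

Lemma combination_sub_ball {Z : normedModType R} (S : 'I_n -> set Z) :
  convex_weights -> (forall i, S i `<=` unit_ball Z) ->
  combination S `<=` unit_ball Z.
Proof.
move=> lw S1 _ [s sS <-]; apply: convex_weights_norm_le => // i.
exact/S1/sS.
Qed.

End combination.

Lemma one_weight_convex {R : realType} : convex_weights (fun _ : 'I_1 => 1 : R).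
Proof. by split=> //; rewrite big_ord1. Qed.

Lemma one_weight_combination {R : realType} {Z : normedModType R}
    (S : 'I_1 -> set Z) : combination (fun _ : 'I_1 => 1 : R) S = S ord0.
Proof.
apply/seteqP; split=> [_ [s sS <-]|z Sz]; first by rewrite big_ord1 scale1r.
exists (fun=> z); last by rewrite big_ord1 scale1r.
by move=> i; rewrite [i]ord1.
Qed.

Lemma one_weight_diameter2 {R : realType} {Z : normedModType R}
    (isS : set Z -> Prop) :
  combinations_have_diameter2 (fun _ : 'I_1 => 1 : R) isS <->
  forall S, isS S -> diameter S = 2%:E.
Proof.
split=> H S HS; last by rewrite one_weight_combination H.
by have := H (fun=> S) (fun=> HS); rewrite one_weight_combination.
Qed.

Lemma convex_combinations_diameter2 {R : realType} {Z : normedModType R}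
    (isS : set Z -> Prop) :
  (forall n (l : 'I_n -> R), convex_weights l -> combinations_have_diameter2 l isS) <->
  forall C, is_convex_combination isS C -> diameter C = 2%:E.
Proof.
split=> [H _ [n [l [S [_ HS l01 l1 ->]]]]|H n l [l0 l1] S HS].
  by apply: H => //; split=> // i; have /andP[] := l01 i.
apply: H; exists n, l, S; split=> //.
  case: n l l0 l1 S HS => // l _ /eqP.
  by rewrite big_ord0 eq_sym oner_eq0.
move=> i; rewrite l0/= -l1 (bigD1 i)//= lerDl.
by apply: sumr_ge0.
Qed.

Section slices.
Context {R : realType} {Z : normedModType R}.

Lemma sliceE (f : dual Z) a z : slice f a z <-> `|z| <= 1 /\ `|f| - a < f z.
Proof. by rewrite /slice dual_supE. Qed.

Lemma wstar_sliceE (z : Z) a f :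
  wstar_slice z a f <-> `|f| <= 1 /\ `|z| - a < f z.
Proof. by rewrite /wstar_slice wstar_supE. Qed.

Lemma slice_sub_ball (S : set Z) : is_slice S -> S `<=` unit_ball Z.
Proof. by move=> [f [a [_ ->]]] z []. Qed.

Lemma wstar_slice_sub_ball (S : set (dual Z)) :
  is_wstar_slice S -> S `<=` unit_ball (dual Z).
Proof. by move=> [f [a [_ ->]]] z []. Qed.

End slices.

(** * Transfer along isometries with the ball property *)

Section transfer.
Context {R : realType} {Z W : normedModType R} (J : {linear Z -> W}).
Hypothesis J_isometry : forall z, `|J z| = `|z|.
Hypothesis J_balls : ball_property J.

(** Take for [S f] a norm preserving extension of the restriction of [f] to [Z]
    (the image of [f] under the L-projection). If the restriction of [f] almost
    attains its norm at [y0], then testing [S f] on [w +- y0 - z] shows that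
    its value at [w] is almost [f (J z)] for every [z] in the ball property for
    [w] and [+- y0], although [f] and [S f] only agree on [Z]. *)
Lemma shadow : exists S : dual W -> dual W, forall f, `|S f| <= `|restr J_isometry f| /\
  forall d, 0 < d -> exists2 y0, `|y0| <= 1 & exists2 e0, 0 < e0 &
    forall w z e, e <= e0 ->
      (forall y, y \in [:: y0; - y0] -> `|w + J y - J z| <= 1 + e) ->
    `|S f w - f (J z)| <= d.
Proof.
suff : forall f : dual W, exists g : dual W, `|g| <= `|restr J_isometry f| /\
  forall d, 0 < d -> exists2 y0, `|y0| <= 1 & exists2 e0, 0 < e0 &
    forall w z e, e <= e0 ->
      (forall y, y \in [:: y0; - y0] -> `|w + J y - J z| <= 1 + e) ->
    `|g w - f (J z)| <= d.
  by move=> /choice[S hS]; exists S.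
move=> f; have [g gf gn] := norm_preserving_extension J_isometry (restr J_isometry f).
have gJ z : g (J z) = f (J z) by rewrite -!(restrE J_isometry) gf.
exists g; split=> // d d0; set c := `|restr J_isometry f| in gn *.
have c0 : 0 <= c by exact: normr_ge0.
have d20 : 0 < d / 2 by lra.
have [y0 y01 hy0] := dual_norm_approx (restr J_isometry f) d20.
rewrite restrE -/c in hy0.
exists y0 => //; exists (d / 2 / (c + 1)); first by rewrite divr_gt0//; lra.
move=> w z e; rewrite ler_pdivlMr ?mulrDr ?mulr1; last by lra.
move=> ecd near; have e10 : 0 <= 1 + e.
  by rewrite (le_trans (normr_ge0 _) (near y0 _))// mem_head.
have bound y : y \in [:: y0; - y0] -> `|g w + g (J y) - g (J z)| <= c + c * e.
  move=> yin; rewrite -linearD -linearB.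
  rewrite ler_norml -[- _ <= _]lerN2 opprK -linearN; set u := _ - J z.
  have uc v : `|v| = `|u| -> g v <= c + c * e.
    move=> vu; rewrite (le_trans (dual_le _ _))// vu.
    rewrite (le_trans (ler_wpM2r _ gn))// (le_trans (ler_wpM2l c0 (near y yin)))//.
    by rewrite mulrDr mulr1.
  by apply/andP; split; apply: uc; rewrite ?normrN.
have := bound y0; have := bound (- y0); rewrite !inE !eqxx ?orbT !linearN/= !gJ.
move=> /(_ isT) + /(_ isT); rewrite !ler_norml => /andP[b1 b2] /andP[b3 b4].
have [e0|e0] := leP 0 e.
  by apply/andP; split; nra.
have : c * e <= 0 by rewrite mulr_ge0_le0// ltW.
by move=> ce; apply/andP; split; lra.
Qed.

Lemma approximation : exists S : dual W -> dual W,
  (forall f, `|S f| <= `|restr J_isometry f|) /\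
  forall (fs : seq (dual W)) (d : R) (w : W) (ys : seq Z), 0 < d -> `|w| <= 1 ->
    (forall y, y \in ys -> `|y| <= 1) ->
  exists z, [/\ `|z| <= 1 + d,
    forall y, y \in ys -> `|w + J y - J z| <= 1 + d &
    forall f, f \in fs -> `|S f w - f (J z)| <= d].
Proof.
have [S hS] := shadow; exists S; split=> [f|fs d w ys d0 w1 ys1].
  by have [] := hS f.
have [test [e0 [e00 test1 testP]]] : exists (test : seq Z) (e0 : R), [/\ 0 < e0,
    forall y, y \in test -> `|y| <= 1 & forall f w z e, f \in fs -> e <= e0 ->
      (forall y, y \in test -> `|w + J y - J z| <= 1 + e) ->
      `|S f w - f (J z)| <= d].
  elim: fs => [|f fs [test [e0 [e00 test1 testP]]]]; first by exists [::], 1.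
  have [_ /(_ d d0)[y0 y01 [e1 e10 hy0]]] := hS f.
  exists (y0 :: - y0 :: test), (Num.min e0 e1); split=> [|y|g u z e].
  - by rewrite lt_min e00.
  - by rewrite !inE => /or3P[/eqP->|/eqP->|/test1]; rewrite ?normrN.
  - rewrite inE le_min => gin /andP[ee0 ee1] near.
    move: gin => /predU1P[->|gfs].
      apply: (hy0 u z e) => // y yin; apply: near; move: yin.
      by rewrite !inE => /orP[]->; rewrite ?orbT.
    by apply: (testP g u z e) => // y yin; apply: near; rewrite !inE yin !orbT.
have m0 : 0 < Num.min d e0 by rewrite lt_min d0.
have md : Num.min d e0 <= d by rewrite ge_min lexx.
have [|z z1 zP] := J_balls w1 _ m0 (ys := ys ++ test).
  by move=> y; rewrite mem_cat => /orP[/ys1|/test1].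
exists z; split=> [|y yin|f fin]; first by rewrite (le_trans z1)// lerD2l.
  by rewrite (le_trans (zP y _)) ?lerD2l// mem_cat yin.
apply: (testP f w z (Num.min d e0)) => //; first by rewrite ge_min lexx orbT.
by move=> y yin; apply: zP; rewrite mem_cat yin orbT.
Qed.

Let rescale_norm d (u : W) : 0 < d -> `|u| <= 1 + d -> `|(1 + d)^-1 *: u| <= 1.
Proof.
move=> d0 ud; have d10 : 0 < 1 + d by lra.
by rewrite normrZ gtr0_norm ?invr_gt0// ler_pdivrMl// mulr1.
Qed.

(** A point [x] where [f - S f] almost attains its norm is moved by the [z] of
    the ball property so that [S f] almost vanishes there. Adding points [y], [y']
    of a slice of the ball of [Z] given by [f] leads to points of the slice of
    [f] with the same difference. *)
Lemma combinations_of_slices_diameter2 n (l : 'I_n -> R) : convex_weights l ->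
  combinations_have_diameter2 l (@is_slice R Z) ->
  combinations_have_diameter2 l (@is_slice R W).
Proof.
move=> lw Zd2 C C_slice.
have [f [a [a0 CE]]] : exists (f : 'I_n -> dual W) (a : 'I_n -> R),
    (forall i, 0 < a i) /\ forall i, C i = slice (f i) (a i).
  suff : forall i, exists p : dual W * R, 0 < p.2 /\ C i = slice p.1 p.2.
    move=> /choice[p hp]; exists (fst \o p), (snd \o p).
    by split=> i; have [] := hp i.
  by move=> i; have [f [a [a0 ->]]] := C_slice i; exists (f, a).
apply/diameter_eq2 => [|e e0].
  by apply: combination_sub_ball => // i; exact: slice_sub_ball.
(* Three errors of size [d], and one of size [`|f i| * d] from the rescaling. *)
pose bound i := a i / (4 + `|f i|).
have bound0 i : 0 < bound i.
  by rewrite divr_gt0//; have := normr_ge0 (f i); lra.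
have [d' d'0 d'b] := common_lower_bound (enum 'I_n) bound0.
pose d := Num.min d' (e / 3).
have d0 : 0 < d by rewrite lt_min d'0 divr_gt0.
have de : d <= e / 3 by rewrite ge_min lexx orbT.
have da i : 4 * d + `|f i| * d <= a i.
  have : d <= a i / (4 + `|f i|).
    rewrite (@le_trans _ _ d')//; first by rewrite ge_min lexx.
    by rewrite d'b// mem_enum.
  by rewrite ler_pdivlMr ?mulrDr; [lra|have := normr_ge0 (f i); lra].
have d10 : 0 < 1 + d by lra.
have [S [Sn Sz]] := approximation.
pose g i := restr J_isometry (f i).
have g_slice i : is_slice (slice (g i) d) by exists (g i), d.
have g_ball : combination l (fun i => slice (g i) d) `<=` unit_ball Z.
  by apply: combination_sub_ball => // i; exact: slice_sub_ball.
have [_ [_ [[y yS <-] [y' y'S <-] yy']]] :=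
  (diameter_eq2 g_ball).1 (Zd2 _ g_slice) d d0.
have [x [x1 xf]] : exists x : 'I_n -> W, (forall i, `|x i| <= 1) /\
    forall i, `|f i - S (f i)| - d < (f i - S (f i)) (x i).
  suff /choice[x hx] : forall i, exists x : W, `|x| <= 1 /\
      `|f i - S (f i)| - d < (f i - S (f i)) x.
    by exists x; split=> i; have [] := hx i.
  by move=> i; have [x x1 xf] := dual_norm_approx (f i - S (f i)) d0; exists x.
have [z hz] : exists z : 'I_n -> Z, forall i,
    [/\ `|x i + J (y i) - J (z i)| <= 1 + d, `|x i + J (y' i) - J (z i)| <= 1 + d &
        `|S (f i) (x i) - f i (J (z i))| <= d].
  suff /choice[z hz] : forall i, exists z : Z,
    [/\ `|x i + J (y i) - J z| <= 1 + d, `|x i + J (y' i) - J z| <= 1 + d &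
        `|S (f i) (x i) - f i (J z)| <= d]
    by exists z.
  move=> i; have /sliceE[y1 _] := yS i; have /sliceE[y'1 _] := y'S i.
  have [|z [_ zy zf]] := Sz [:: f i] d (x i) [:: y i; y' i] d0 (x1 i).
    by move=> u; rewrite !inE => /orP[]/eqP->.
  exists z; split; [apply: zy|apply: zy|exact/zf/mem_head].
    exact: mem_head.
  by rewrite in_cons mem_head orbT.
pose lift (u : 'I_n -> Z) i := (1 + d)^-1 *: (x i + J (u i) - J (z i)).
have lift_slice u i : slice (g i) d (u i) ->
    `|x i + J (u i) - J (z i)| <= 1 + d -> C i (lift u i).
  move=> /sliceE[u1 ug] un; rewrite CE; apply/sliceE; split.
    exact: rescale_norm.
  rewrite /lift linearZ/= linearB linearD/= ltr_pdivlMl//.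
  rewrite /g restrE in ug.
  have := xf i; rewrite dualB; have [_ _] := hz i; rewrite ler_norml => /andP[z1 z2].
  have : `|f i| <= `|f i - S (f i)| + `|S (f i)|.
    by rewrite -[f i in leLHS](subrK (S (f i))) ler_normD.
  have := Sn (f i); rewrite -/(g i); have := da i; have := mulr_gt0 (a0 i) d0.
  rewrite mulrBr !mulrDl !mul1r; have := normr_ge0 (f i).
  move: `|f i| => F; move: (a i) => A.
  lra.
exists (\sum_i l i *: lift y i), (\sum_i l i *: lift y' i); split.
- by exists (lift y) => // i; apply: lift_slice => //; have [] := hz i.
- by exists (lift y') => // i; apply: lift_slice => //; have [] := hz i.
have -> : \sum_i l i *: lift y i - \sum_i l i *: lift y' i =
    (1 + d)^-1 *: J (\sum_i l i *: y i - \sum_i l i *: y' i).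
  rewrite -!sumrB linear_sum scaler_sumr; apply: eq_bigr => i _.
  rewrite -!scalerBr [J (_ *: _)]linearZ/= [RHS]scalerA mulrC -scalerA [J (_ - _)]linearB/=.
  congr (_ *: (_ *: _)); rewrite opprB addrA subrK.
  by rewrite opprD addrACA subrr add0r.
rewrite normrZ gtr0_norm ?invr_gt0// J_isometry ltr_pdivlMl//.
nra.
Qed.

(** If [z0] is given by the ball property for [w0], then [z0 / (1 + d)] is a point
    of the ball of [Z] where the functionals in [fs] have almost the values
    [S f w0]. Its weak neighbourhood contains [y], [y'] at distance almost [2],
    and adding [w0 - z], with [z] such that [f (J z)] is again almost [S f w0],
    moves them to the given weak neighbourhood of [w0]. *)
Lemma D2P_transfer : D2P Z -> D2P W.
Proof.
move=> Zd2 U oU [w0 [Uw0 w01]]; apply/diameter_eq2; first by move=> w [].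
move=> e e0; have [fs [r [r0 rU]]] := initial_ptws_basis oU Uw0.
(* Three errors of size [d], and two of size [`|f| * d] from the rescaling. *)
pose bound (f : dual W) := r / (4 + 2 * `|f|).
have bound0 f : 0 < bound f.
  by rewrite divr_gt0//; have := normr_ge0 f; lra.
have [d' d'0 d'b] := common_lower_bound fs bound0.
pose d := Num.min d' (e / 3).
have d0 : 0 < d by rewrite lt_min d'0 divr_gt0.
have de : d <= e / 3 by rewrite ge_min lexx orbT.
have dr f : f \in fs -> 4 * d + 2 * `|f| * d <= r.
  move=> fin; have : d <= r / (4 + 2 * `|f|).
    rewrite (@le_trans _ _ d')//; first by rewrite ge_min lexx.
    exact: d'b.
  by rewrite ler_pdivlMr ?mulrDr; [lra|have := normr_ge0 f; lra].
have d10 : 0 < 1 + d by lra.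
have [S [_ Sz]] := approximation.
have [//|z0 [z01 _ z0f]] := Sz fs d w0 [::] d0 w01.
pose y0 := (1 + d)^-1 *: z0.
have y01 : `|y0| <= 1.
  by rewrite normrZ gtr0_norm ?invr_gt0// ler_pdivrMl// mulr1.
pose V : set (weak Z) := [set y | forall g, g \in map (restr J_isometry) fs ->
  `|(g : dual Z) y - g y0| < d].
have oV : open V by exact: initial_ptws_open.
have V_ball : (V : set Z) `&` unit_ball Z `<=` unit_ball Z by move=> y [].
have Vy0 : ((V : set Z) `&` unit_ball Z) y0.
  by split=> // g _; rewrite subrr normr0.
have [y [y' [[Vy y1] [Vy' y'1] yy']]] :=
  (diameter_eq2 V_ball).1 (Zd2 V oV (ex_intro _ y0 Vy0)) d d0.
have [|z [_ zy zf]] := Sz fs d w0 [:: y; y'] d0 w01.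
  by move=> u; rewrite !inE => /orP[]/eqP->.
pose lift u := (1 + d)^-1 *: (w0 + J u - J z).
have lift_near u : V u -> `|w0 + J u - J z| <= 1 + d -> (U `&` unit_ball W) (lift u).
  move=> Vu un; split; last exact: rescale_norm.
  apply: rU => f fin; rewrite /lift linearZ/= linearB linearD/=.
  have /Vu : restr J_isometry f \in map (restr J_isometry) fs by exact: map_f.
  rewrite !restrE /y0 linearZ/= linearZ/=.
  have := zf f fin; have := z0f f fin; have := dr f fin.
  have fz0 : `|(1 + d)^-1 * f (J z0)| <= `|f|.
    rewrite -[X in f X]/(J z0) -linearZ dual_norm_ge// rescale_norm//.
    by rewrite J_isometry.
  have fw0 : `|f w0| <= `|f| by exact: dual_norm_ge.
  have -> : (1 + d)^-1 * (f w0 + f (J u) - f (J z)) - f w0 =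
      (1 + d)^-1 * (f (J u) - f (J z) - d * f w0).
    by apply: (mulfI (lt0r_neq0 d10)); rewrite mulrBr !mulVKf ?lt0r_neq0//; ring.
  move: fz0; have -> : f (J z0) = (1 + d) * ((1 + d)^-1 * f (J z0)).
    by rewrite mulVKf// lt0r_neq0.
  rewrite mulKf ?lt0r_neq0//; move: ((1 + d)^-1 * f (J z0)) => q qf fr.
  rewrite normrM gtr0_norm ?invr_gt0// => qS zS uq.
  rewrite ltr_pdivrMl// (@le_lt_trans _ _ r)//; last by rewrite ltr_pMl//; lra.
  move: qf fw0 qS zS uq; rewrite !ler_norml !ltr_norml.
  move=> /andP[q1 q2] /andP[w1 w2] /andP[a1 a2] /andP[b1 b2] /andP[c1 c2].
  have dq1 := ler_wpM2l (ltW d0) q1; have dq2 := ler_wpM2l (ltW d0) q2.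
  have dw1 := ler_wpM2l (ltW d0) w1; have dw2 := ler_wpM2l (ltW d0) w2.
  by apply/andP; split; lra.
exists (lift y), (lift y'); split.
- by apply: lift_near => //; apply: zy; rewrite mem_head.
- by apply: lift_near => //; apply: zy; rewrite in_cons mem_head orbT.
have -> : lift y - lift y' = (1 + d)^-1 *: J (y - y').
  by rewrite /lift -scalerBr [J (_ - _)]linearB/= opprB addrA subrK opprD addrACA subrr add0r.
rewrite normrZ gtr0_norm ?invr_gt0// J_isometry ltr_pdivlMl//.
nra.
Qed.

(** A functional of the ball of the dual of [W] that almost attains norm [1] at
    a point [e] of [Z] almost vanishes on [w - z] as soon as both [w + e - z]
    and [w - e - z] are almost in the unit ball. Hence functionals with this
    property that are far apart on [W] are still far apart on [Z]. *)
Lemma concentration (es : seq Z) (d : R) (w : W) : 0 < d -> `|w| <= 1 ->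
    (forall e, e \in es -> `|e| <= 1) ->
  exists2 z, `|z| <= 1 + d & forall (f : dual W) e, `|f| <= 1 -> e \in es ->
    1 - d < f (J e) -> `|f w - f (J z)| <= 2 * d.
Proof.
move=> d0 w1 es1.
have [|z z1 zP] := J_balls w1 _ d0 (ys := es ++ map -%R es).
  move=> y; rewrite mem_cat => /orP[/es1//|/mapP[e /es1 e1 ->]].
  by rewrite normrN.
exists z => // f e f1 ein fe.
have := zP e; rewrite mem_cat ein => /(_ isT) ze.
have := zP (- e); rewrite mem_cat map_f// orbT => /(_ isT) zNe.
have bound u : `|u| <= 1 + d -> - (1 + d) <= f u <= 1 + d.
  move=> ud; apply/andP; split; last exact: le_trans (dual_ball_le u f1) ud.
  by rewrite -lerN2 opprK -linearN (le_trans (dual_ball_le _ f1))// normrN.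
have := bound _ ze; have := bound _ zNe; rewrite !linearB !linearD/= !linearN/=.
by move=> /andP[b1 b2] /andP[b3 b4]; rewrite ler_norml; apply/andP; split; lra.
Qed.

Lemma unit_vector (z : Z) : (exists u : Z, u != 0) ->
  exists2 e : Z, `|e| = 1 & z = `|z| *: e.
Proof.
move=> [u u0]; have [->|z0] := eqVneq z 0.
  by exists (`|u|^-1 *: u); [rewrite normfZV|rewrite normr0 scale0r].
exists (`|z|^-1 *: z); first by rewrite normfZV.
by rewrite scalerA divff ?scale1r// normr_eq0.
Qed.

(** Each slice of the dual ball of [Z] given by [z] contains the restrictions of
    the slice of the dual ball of [W] given by [z / `|z|], if that slice is thin
    enough; for [z = 0] any unit vector will do, since the slice is the ball. *)
Lemma combinations_of_wstar_slices_diameter2 n (l : 'I_n -> R) :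
  (exists u : Z, u != 0) -> convex_weights l ->
  combinations_have_diameter2 l (@is_wstar_slice R W) ->
  combinations_have_diameter2 l (@is_wstar_slice R Z).
Proof.
move=> Z0 lw Wd2 C C_slice.
have [z [a [a0 CE]]] : exists (z : 'I_n -> Z) (a : 'I_n -> R),
    (forall i, 0 < a i) /\ forall i, C i = wstar_slice (z i) (a i).
  suff : forall i, exists p : Z * R, 0 < p.2 /\ C i = wstar_slice p.1 p.2.
    move=> /choice[p hp]; exists (fst \o p), (snd \o p).
    by split=> i; have [] := hp i.
  by move=> i; have [z [a [a0 ->]]] := C_slice i; exists (z, a).
have [u [u1 zu]] : exists u : 'I_n -> Z,
    (forall i, `|u i| = 1) /\ forall i, z i = `|z i| *: u i.
  suff /choice[u hu] : forall i, exists u, `|u| = 1 /\ z i = `|z i| *: u.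
    by exists u; split=> i; have [] := hu i.
  by move=> i; have [u u1 zu] := unit_vector (z i) Z0; exists u.
apply/diameter_eq2 => [|e e0].
  by apply: combination_sub_ball => // i; exact: wstar_slice_sub_ball.
pose bound i := a i / (1 + `|z i|).
have bound0 i : 0 < bound i by rewrite divr_gt0//; have := normr_ge0 (z i); lra.
have [d' d'0 d'b] := common_lower_bound (enum 'I_n) bound0.
pose d := Num.min d' (e / 8).
have d0 : 0 < d by rewrite lt_min d'0 divr_gt0.
have de : d <= e / 8 by rewrite ge_min lexx orbT.
have da i : d + `|z i| * d <= a i.
  have : d <= a i / (1 + `|z i|).
    rewrite (@le_trans _ _ d')//; first by rewrite ge_min lexx.
    by rewrite (le_trans (d'b i _))// mem_enum.
  by rewrite ler_pdivlMr ?mulrDr; [lra|have := normr_ge0 (z i); lra].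
have D_slice i : is_wstar_slice (wstar_slice (J (u i)) d) by exists (J (u i)), d.
have D_ball : combination l (fun i => wstar_slice (J (u i)) d) `<=` unit_ball (dual W).
  by apply: combination_sub_ball => // i; exact: wstar_slice_sub_ball.
have [_ [_ [[f fD <-] [g gD <-] fg]]] := (diameter_eq2 D_ball).1 (Wd2 _ D_slice) d d0.
have restr_slice h i : wstar_slice (J (u i)) d h -> C i (restr J_isometry h).
  move=> /wstar_sliceE[h1]; rewrite J_isometry u1 => hu; rewrite CE.
  apply/wstar_sliceE; split; first exact: le_trans (restr_norm_le _ _) h1.
  rewrite restrE [in ltRHS]zu linearZ/= linearZ/=.
  have := ler_wpM2l (normr_ge0 (z i)) (ltW hu); have := da i.
  rewrite mulrBr mulr1; lra.
have [w w1 hw] := dual_norm_approx (\sum_i l i *: f i - \sum_i l i *: g i) d0.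
have [|v v1 vP] := @concentration [seq u i | i <- enum 'I_n] d w d0 w1.
  by move=> _ /mapP[i _ ->]; rewrite u1.
have near h i : wstar_slice (J (u i)) d h -> `|h w - h (J v)| <= 2 * d.
  move=> /wstar_sliceE[h1]; rewrite J_isometry u1; apply: vP => //.
  by rewrite map_f// mem_enum.
exists (\sum_i l i *: restr J_isometry (f i)), (\sum_i l i *: restr J_isometry (g i)).
split.
- by exists (restr J_isometry \o f) => // i; exact: restr_slice.
- by exists (restr J_isometry \o g) => // i; exact: restr_slice.
set H := (X in `|X|); have Hv : H v = \sum_i l i * (f i (J v) - g i (J v)).
  by rewrite dualB !dual_sum -sumrB; apply: eq_bigr => i _; rewrite mulrBr.
have {hw} : 2 - 2 * d < (\sum_i l i *: f i - \sum_i l i *: g i) w by lra.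
rewrite dualB !dual_sum -sumrB.
under eq_bigr do rewrite !dualZ -mulrBr.
move=> hw; have diff : \sum_i l i * (f i w - g i w) <= H v + 4 * d.
  have [l0 l1] := lw; rewrite Hv -[4 * d]mul1r -[X in X * (4 * d)]l1 mulr_suml -big_split/=.
  apply: ler_sum => i _; rewrite -mulrDr ler_wpM2l//.
  have := near _ i (fD i); have := near _ i (gD i); rewrite !ler_norml.
  by move=> /andP[? ?] /andP[? ?]; lra.
have Hle : H v <= `|H| * (1 + d).
  by rewrite (le_trans (dual_le H v))// ler_wpM2l.
rewrite ltNge; apply/negP => He; have d10 : 0 <= 1 + d by lra.
have := ler_wpM2r d10 He; have := sqr_ge0 d; nra.
Qed.

(** Two functionals of the dual ball of [Z] at distance almost [2], both close on
    [zs] to a given one of norm almost [1]: the w*-neighbourhood in the dual of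
    [W] is chosen so that it also makes [f (J e)] almost [1]. *)
Let wstar_far_apart (zs : seq Z) (g : dual Z) (r d : R) : wstar_D2P W ->
  0 < r -> 0 < d -> `|g| <= 1 -> 1 - d < `|g| ->
  exists g1 g2 : dual Z, [/\ `|g1| <= 1, `|g2| <= 1,
    forall z, z \in zs -> `|g1 z - g z| < r /\ `|g2 z - g z| < r &
    2 - 7 * d < `|g1 - g2|].
Proof.
move=> Wd2 r0 d0 g1 gd.
have [e e1 ge] : exists2 e, `|e| <= 1 & 1 - d < g e.
  have gd0 : 0 < `|g| - (1 - d) by lra.
  by have [e e1 he] := dual_norm_approx g gd0; exists e => //; lra.
have [f0 f0g f0n] := norm_preserving_extension J_isometry g.
have f0J z : f0 (J z) = g z by rewrite -f0g.
pose r' := Num.min r (g e - (1 - d)).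
have r'0 : 0 < r' by rewrite lt_min r0; lra.
pose V : set (weak_star W) := [set f | forall w, w \in map J (e :: zs) ->
  `|(f : dual W) w - f0 w| < r'].
have oV : open V by exact: (initial_ptws_open _ _ (f0 : W -> R)).
have V_ball : (V : set (dual W)) `&` unit_ball (dual W) `<=` unit_ball (dual W).
  by move=> f [].
have Vf0 : ((V : set (dual W)) `&` unit_ball (dual W)) f0.
  by split=> [w _|]; [rewrite subrr normr0|exact: le_trans f0n g1].
have [f1 [f2 [[V1 f11] [V2 f21] far]]] :=
  (diameter_eq2 V_ball).1 (Wd2 V oV (ex_intro _ f0 Vf0)) d d0.
have far0 : 0 < `|f1 - f2| - (2 - d) by rewrite subr_gt0.
have [w w1 hw] := dual_norm_approx (f1 - f2) far0.
have [|v v1 vP] := @concentration [:: e] d w d0 w1.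
  by move=> u; rewrite inE => /eqP->.
have V_near (f : dual W) z : V f -> z \in e :: zs -> `|f (J z) - g z| < r'.
  by move=> Vf zin; rewrite -f0J; apply: Vf; exact: map_f.
have V_e (f : dual W) : V f -> 1 - d < f (J e).
  move=> /(V_near _ e)/(_ (mem_head _ _)); rewrite lt_min ltr_norml => /andP[_].
  by rewrite ltr_norml => /andP[+ _]; lra.
exists (restr J_isometry f1), (restr J_isometry f2); split.
- exact: le_trans (restr_norm_le _ _) f11.
- exact: le_trans (restr_norm_le _ _) f21.
- move=> z zin; have zin' : z \in e :: zs by rewrite in_cons zin orbT.
  have := V_near f1 z V1 zin'; have := V_near f2 z V2 zin'.
  by rewrite !lt_min => /andP[? _] /andP[? _].
have := vP f1 e f11 (mem_head _ _) (V_e _ V1).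
have := vP f2 e f21 (mem_head _ _) (V_e _ V2).
move: hw; rewrite dualB !ler_norml => hw /andP[? ?] /andP[? ?].
have := dual_le (restr J_isometry f1 - restr J_isometry f2) v.
rewrite dualB !restrE; set D := restr J_isometry f1 - _.
move=> /le_trans/(_ (ler_wpM2l (normr_ge0 D) v1)).
by have := normr_ge0 D; nra.
Qed.

(** A w*-open set [U] that meets the dual ball contains functionals of that ball
    with norm almost [1]. Otherwise a whole slab around a point of [U] would
    stay inside the ball, as the norm cannot jump over the values between [1 - d]
    and [1]. The norm of the dual of [Z] would then be controlled by the values
    on the finitely many [zs], and functionals that are close on [zs] could not
    be far apart. *)
Lemma wstar_D2P_transfer : (exists u : Z, u != 0) -> wstar_D2P W -> wstar_D2P Z.
Proof.
move=> Z0 Wd2 U oU [g0 [Ug0 g01]].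
apply/diameter_eq2; first by move=> w [].
move=> e e0; pose d := Num.min (e / 7) (1 / 2).
have d0 : 0 < d by rewrite lt_min !divr_gt0.
have [de d1] : d <= e / 7 /\ d <= 1 / 2 by rewrite !ge_min !lexx orbT.
have [g [Ug g1 gd]] : exists g : dual Z, [/\ U g, `|g| <= 1 & 1 - d < `|g|].
  apply: contrapT => short.
  have Ushort (g : dual Z) : U g -> `|g| <= 1 -> `|g| <= 1 - d.
    by move=> Ug g1; rewrite leNgt; apply/negP => gd; apply: short; exists g.
  have [zs [r [r0 rU]]] := initial_ptws_basis oU Ug0.
  have slab (h : dual Z) : (forall z, z \in zs -> `|h z| < r) -> `|h| <= 2.
    move=> hr; pose N := (Num.bound (`|h| / d)).+1.
    have N0 : 0 < N%:R :> R by rewrite ltr0n.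
    have hN : `|N%:R^-1 *: h| <= d.
      rewrite normrZ gtr0_norm ?invr_gt0// ler_pdivrMl//.
      rewrite -ler_pdivrMr// ltW//.
      rewrite (lt_trans (archi_boundP _)) ?ltr_nat//.
      by rewrite divr_ge0// ltW.
    (* Walking from [g0] to [g0 + h] in [N] steps of norm at most [d], one stays in
       the ball and in [U], hence below norm [1 - d], all the way. *)
    have step k : (k <= N)%N -> `|g0 + (k%:R / N%:R) *: h| <= 1 - d.
      elim: k => [_|k IH kN]; first by rewrite mul0r scale0r addr0 Ushort.
      have := IH (ltnW kN) => IHk; apply: Ushort.
        apply: rU => z zin; rewrite dualD dualZ addrAC subrr add0r normrM.
        rewrite ger0_norm ?divr_ge0// (le_lt_trans _ (hr z zin))// ler_piMl//.
        by rewrite ler_pdivrMr// mul1r ler_nat.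
      rewrite -natr1 mulrDl mul1r scalerDl addrA (le_trans (ler_normD _ _))//.
      by rewrite (le_trans (lerD IHk hN))// subrK.
    have := step N (leqnn N); rewrite divff ?gt_eqF// scale1r => h1.
    rewrite -[h](addKr g0) (le_trans (ler_normD _ _))// normrN.
    by move: g01; rewrite /unit_ball/=; lra.
  (* Two functionals within [r / 8] of [f] on [zs] differ there by at most [r / 4],
     hence by at most [1] in norm, but may be chosen more than [13 / 10] apart. *)
  have [u u1 _] := unit_vector 0 Z0; have [f f1 fu] := norming_functional u.
  have fn : 1 - 1 / 10 < `|f| :> R.
    have := dual_le f u; rewrite fu u1 mulr1; lra.
  have r8 : 0 < r / 8 by rewrite divr_gt0.
  have d10 : 0 < 1 / 10 :> R by rewrite divr_gt0.
  have [h1 [h2 [_ _ near far]]] := wstar_far_apart zs Wd2 r8 d10 f1 fn.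
  suff : `|2 *: (h1 - h2)| <= 2 by rewrite normrZ gtr0_norm//; lra.
  apply: slab => z /near[]; rewrite dualZ dualB !ltr_norml.
  by move=> /andP[? ?] /andP[? ?]; apply/andP; split; lra.
have [zs [r [r0 rU]]] := initial_ptws_basis oU Ug.
have [g' [g'' [g'1 g''1 near far]]] := wstar_far_apart zs Wd2 r0 d0 g1 gd.
exists g', g''; split.
- by split=> //; apply: rU => z /near[].
- by split=> //; apply: rU => z /near[].
- lra.
Qed.

End transfer.

Theorem corollary7 (R : realType) (K : topologicalType)
    (K_compact : compact [set: K]) (K_hausdorff : hausdorff_space K)
    (K_nonempty : [set: K] !=set0)
    (X : completeNormedModType R) (Y : submodClosed X)
    (Y_nonzero : exists2 y : X, y \in Y & y != 0)
    (Y_M_ideal : M_ideal Y) (Y_proper : [set` Y] <> [set: X]) :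
  let CKX := contfun K_compact X in
  let CKY := contfun K_compact (subnormed Y) in
  [/\ strong_D2P CKY -> strong_D2P CKX,
      D2P CKY -> D2P CKX &
      slice_D2P CKY -> slice_D2P CKX] /\
  [/\ wstar_strong_D2P CKX -> wstar_strong_D2P CKY,
      wstar_D2P CKX -> wstar_D2P CKY &
      wstar_slice_D2P CKX -> wstar_slice_D2P CKY].
Proof.
move=> CKX CKY.
pose incl : {linear subnormed Y -> X} := \val.
have incl_isometry y : `|incl y| = `|y| by [].
pose J : {linear CKY -> CKX} :=
  @contfun_comp R K K_compact _ X incl incl_isometry.
have J_isometry : forall g, `|J g| = `|g| by exact: contfun_comp_isometry.
have J_balls : ball_property J.
  exact/ball_property_contfun/M_ideal_ball_property.
have CKY_nonzero : exists g : CKY, g != 0.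
  have [[t _] [y yY y0]] := (K_nonempty, Y_nonzero).
  have cst_cont : continuous (fun _ : K => SubNormed yY) by exact: cst_continuous.
  exists (ContFun K_compact (mem_set cst_cont)).
  apply: contra_neq y0 => g0.
  by have /(congr1 (fun g : CKY => \val (g t))) := g0.
split; split.
- move=> /convex_combinations_diameter2 HY.
  apply/convex_combinations_diameter2 => n l lw.
  exact: (combinations_of_slices_diameter2 J_isometry J_balls lw (HY n l lw)).
- exact: (D2P_transfer J_isometry J_balls).
- move=> /one_weight_diameter2 HY; apply/one_weight_diameter2.
  exact: (combinations_of_slices_diameter2 J_isometry J_balls one_weight_convex HY).
- move=> /convex_combinations_diameter2 HX.
  apply/convex_combinations_diameter2 => n l lw.
  exact: (combinations_of_wstar_slices_diameter2 J_isometry J_balls CKY_nonzero lw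
    (HX n l lw)).
- exact: (wstar_D2P_transfer J_isometry J_balls CKY_nonzero).
- move=> /one_weight_diameter2 HX; apply/one_weight_diameter2.
  exact: (combinations_of_wstar_slices_diameter2 J_isometry J_balls CKY_nonzero
    one_weight_convex HX).
Qed.
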